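(* Let $\tau>0$. With the setting and notation of the context (symmetric positive definite matrix $A\in\mathbb{R}^{n\times n}$, overlapping decomposition into $N$ subdomains, near-kernel subspace $G$, local matrices $B_i=R_iAR_i^T$, coarse space $V_0=V_G+V^\tau_{geneo}$ with basis matrix $Z$, and $P_0=Z(Z^TAZ)^{-1}Z^TA$), define the additive Schwarz with GenEO preconditioner $$M^{-1}_{AS,2} := Z(Z^TAZ)^{-1}Z^T+(I-P_0)\sum_{i=1}^N R_i^T(R_iAR_i^T)^{-1}R_i\,(I-P_0^T).$$ Then the spectral condition number of the preconditioned operator satisfies $$\kappa(M^{-1}_{AS,2}A)\le (1+k_1\tau)\,k_0 .$$
   Context: All scalar products $(\cdot,\cdot)$ are Euclidean. $A\in\mathbb{R}^{n\times n}$ is a symmetric positive definite (SPD) matrix arising from a conforming finite element discretisation of a symmetric coercive bilinear form $a$ on a domain $\Omega$; write $a(\mathbf U,\mathbf V)=(A\mathbf U,\mathbf V)$. The form is a sum over mesh elements, $a=\sum_{K} a_K$, with each $a_K$ a symmetric positive semidefinite bilinear form on $\mathbb{R}^n$. $\Omega$ is covered by $N$ overlapping subdomains $\Omega_i$, each a union of mesh elements. $R_i\in\mathbb{R}^{n_i\times n}$ is the Boolean restriction matrix selecting the $n_i$ degrees of freedom of $\Omega_i$. $D_i\in\mathbb{R}^{n_i\times n_i}$ are diagonal matrices forming a partition of unity: $\sum_{i=1}^N R_i^TD_iR_i=I$. The local Neumann matrix $A_i^{Neu}\in\mathbb{R}^{n_i\times n_i}$ is defined by $(A_i^{Neu}R_i\mathbf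 U,R_i\mathbf V)=\sum_{K\subset\Omega_i}a_K(\mathbf U,\mathbf V)$ for all $\mathbf U,\mathbf V\in\mathbb{R}^n$ (the right side depends only on $R_i\mathbf U,R_i\mathbf V$), and is assumed SPD. $k_0:=\max_{1\le i\le N}\#\{j : R_jAR_i^T\neq 0\}$ is the maximal number of neighbours of a subdomain (including itself). $k_1$ is the maximal multiplicity of subdomain intersections, i.e. the largest number of subdomains sharing a common mesh element. $G\subset\mathbb{R}^n$ is a given subspace (the near-kernel of $A$), $G_i:=R_iG\subset\mathbb{R}^{n_i}$, and $V_G:=\sum_{i=1}^N R_i^TD_iG_i\subset\mathbb{R}^n$. $B_i:=R_iAR_i^T$, and $\xi_{0i}$ is the $B_i$-orthogonal projection of $\mathbb{R}^{n_i}$ onto $G_i$. GenEO coarse space: for each $1\le j\le N$, consider the generalized eigenvalue problem of finding $(\mathbf V_{jk},\lambda_{jk})\in(\mathbb{R}^{n_j}\setminus\{0\})\times\mathbb{R}$ with $$(I-\xi_{0j}^T)D_jR_jAR_j^TD_j(I-\xi_{0j})\mathbf V_{jk}=\lambda_{jk}A_j^{Neu}\mathbf V_{jk},$$ where $(\mathbf V_{jk})_k$ is a basis of $\mathbb{R}^{n_j}$ of eigenvectors. For a threshold $\tau>0$, $V^\tau_{geneo}\subset\mathbb{R}^n$ is the span of all vectors $R_j^TD_j(I-\xi_{0j})\mathbf V_{jk}$ with $1\le j\le N$ and $\lambda_{jk}>\tau$. The coarse space is $V_0:=V_G+V^\tau_{geneo}$, and $Z$ is a full-column-rank matrix whose columns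 form a basis of $V_0$. $P_0=Z(Z^TAZ)^{-1}Z^TA$ is then the $A$-orthogonal projection onto $V_0$. For an SPD $M^{-1}$, $\kappa(M^{-1}A)$ denotes the ratio of the largest to the smallest eigenvalue of $M^{-1}A$. *)

(* Defs.v *)
From mathcomp Require Export all_boot all_order all_algebra.
From mathcomp Require Export boolp classical_sets reals.

Set Implicit Arguments.
Unset Strict Implicit.
Unset Printing Implicit Defensive.

Import Order.TTheory GRing.Theory Num.Theory.
Local Open Scope ring_scope.

Section LinearAlgebra.
Context {R : realType}.

Definition dot n (u v : 'cV[R]_n) : R := (u^T *m v) 0 0.

Definition spd n (A : 'M[R]_n) : Prop :=
  A^T = A /\ forall u : 'cV[R]_n, u != 0 -> 0 < dot (A *m u) u.

(* The set of eigenvalues is finite, and nonempty when [X] is the product of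
   two SPD matrices of positive size, so [sup] and [inf] are then the largest
   and the smallest eigenvalue.  ([eigenvalue] uses left eigenvectors, which
   gives the same eigenvalues as right eigenvectors.) *)
Definition spectral_cond n (X : 'M[R]_n) : R :=
  sup [set a : R | eigenvalue X a]%classic
  / inf [set a : R | eigenvalue X a]%classic.

Definition columns_basis n m (Z : 'M[R]_(n, m)) (V : {vspace 'cV[R]_n}) : Prop :=
  basis_of V [seq col k Z | k : 'I_m].

(* [xi] is the projection onto [G] that is orthogonal for (u, v) |-> (B u, v). *)
Definition is_orth_proj n (B : 'M[R]_n) (G : {vspace 'cV[R]_n})
    (xi : 'M[R]_n) : Prop :=
  forall u : 'cV[R]_n,
    xi *m u \in G /\
    forall v : 'cV[R]_n, v \in G -> dot (B *m (u - xi *m u)) v = 0.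

End LinearAlgebra.

Section Decomposition.
Context {R : realType} (n N : nat).

(* The mesh is the finite type [E] of its elements, [edof K] is the set of
   degrees of freedom carried by the element [K], and a union of mesh elements
   is given by the set of these elements. *)
Definition dofs_of (E : finType) (edof : E -> {set 'I_n}) (Om : {set E}) :
    {set 'I_n} := \bigcup_(K in Om) edof K.

(* The local numbering [s] of the selected degrees of freedom is arbitrary. *)
Definition is_restriction m (S : {set 'I_n}) (Ri : 'M[R]_(m, n)) : Prop :=
  exists s : 'I_m -> 'I_n,
    [/\ injective s, codom s =i S & Ri = \matrix_(k, j) (s k == j)%:R].

Definition max_multiplicity (E : finType) (Om : 'I_N -> {set E}) : nat :=
  \max_(K : E) #|[set i : 'I_N | K \in Om i]|.

Context (nloc : 'I_N -> nat).
Implicit Types (A : 'M[R]_n) (Rs : forall i, 'M[R]_(nloc i, n)).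
Implicit Types (D xi : forall i, 'M[R]_(nloc i)).

Definition max_neighbours A Rs : nat :=
  \max_(i < N) #|[set j : 'I_N | (Rs j *m A *m (Rs i)^T != 0)%R]|.

Definition Bloc A Rs (i : 'I_N) : 'M[R]_(nloc i) := Rs i *m A *m (Rs i)^T.

Definition Gloc Rs (G : {vspace 'cV[R]_n}) (i : 'I_N) :
    {vspace 'cV[R]_(nloc i)} := (linfun (mulmx (Rs i)) @: G)%VS.

Definition V_G Rs D G : {vspace 'cV[R]_n} :=
  (\sum_(i < N) linfun (mulmx ((Rs i)^T *m D i)) @: Gloc Rs G i)%VS.

Definition geneo_mx A Rs D xi (j : 'I_N) : 'M[R]_(nloc j) :=
  (1%:M - (xi j)^T) *m D j *m Rs j *m A *m (Rs j)^T *m D j *m (1%:M - xi j).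

Definition is_eigenbasis m (L P : 'M[R]_m)
    (V : 'I_m -> 'cV[R]_m) (lam : 'I_m -> R) : Prop :=
  basis_of fullv [seq V k | k : 'I_m] /\
  forall k, V k != 0 /\ L *m V k = lam k *: (P *m V k).

Definition V_geneo Rs D xi (V : forall j, 'I_(nloc j) -> 'cV[R]_(nloc j))
    (lam : forall j, 'I_(nloc j) -> R) (tau : R) : {vspace 'cV[R]_n} :=
  (\sum_(j < N) \sum_(k < nloc j | (tau < lam j k)%R)
     <[(Rs j)^T *m D j *m (1%:M - xi j) *m V j k]>)%VS.

Definition P0 m A (Z : 'M[R]_(n, m)) : 'M[R]_n :=
  Z *m invmx (Z^T *m A *m Z) *m Z^T *m A.

Definition MAS2_inv m A Rs (Z : 'M[R]_(n, m)) : 'M[R]_n :=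
  Z *m invmx (Z^T *m A *m Z) *m Z^T
  + (1%:M - P0 A Z)
    *m (\sum_(i < N) (Rs i)^T *m invmx (Bloc A Rs i) *m Rs i)
    *m (1%:M - (P0 A Z)^T).

End Decomposition.

(* Main.v *)
Require Import Defs.
From mathcomp Require Import ring lra.

(** Writing [a(u, v) = (A u, v)], [w = u - P0 u] and [P_i] for the [a]-orthogonal
    projection onto the range of [R_i^T], the preconditioned operator satisfies
    [a(M^-1 A u, u) = a(P0 u, P0 u) + \sum_i a(P_i w, w)].  Non-neighbouring
    ranges are [a]-orthogonal, so [\sum_i a(P_i w, w) <= k0 a(w, w)], which gives
    the upper bound [k0].  For the lower bound, [u] is split by the partition of
    unity, and everything in [D_i R_i u] except the image [U_i] of the part of
    [R_i u] below the GenEO threshold is lifted into [V0], so that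
    [w = (1 - P0) \sum_i R_i^T U_i]; the eigenvalue problem bounds the energy of
    [U_i] by [tau] times the Neumann energy of [R_i u], and the Neumann energies
    sum up to at most [k1 a(u, u)].  Young's inequality then gives
    [a(u, u) <= (1 + k1 tau) a(M^-1 A u, u)]. *)

Set Implicit Arguments.
Unset Strict Implicit.
Unset Printing Implicit Defensive.

Import Order.TTheory GRing.Theory Num.Theory.
Local Open Scope ring_scope.

(** * Bilinearity and adjoints for the Euclidean scalar product *)

Section Dot.
Context {R : realType}.

Lemma dotC n (u v : 'cV[R]_n) : dot u v = dot v u.
Proof. by rewrite /dot -[in RHS](trmxK u) -trmx_mul [RHS]mxE. Qed.

Lemma dotDl n (u v w : 'cV[R]_n) : dot (u + v) w = dot u w + dot v w.
Proof. by rewrite /dot linearD mulmxDl mxE. Qed.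

Lemma dotDr n (u v w : 'cV[R]_n) : dot u (v + w) = dot u v + dot u w.
Proof. by rewrite dotC dotDl !(dotC u). Qed.

Lemma dotZl n c (u v : 'cV[R]_n) : dot (c *: u) v = c * dot u v.
Proof. by rewrite /dot linearZ -scalemxAl mxE. Qed.

Lemma dotZr n c (u v : 'cV[R]_n) : dot u (c *: v) = c * dot u v.
Proof. by rewrite dotC dotZl dotC. Qed.

Lemma dotNl n (u v : 'cV[R]_n) : dot (- u) v = - dot u v.
Proof. by rewrite -scaleN1r dotZl mulN1r. Qed.

Lemma dotNr n (u v : 'cV[R]_n) : dot u (- v) = - dot u v.
Proof. by rewrite -scaleN1r dotZr mulN1r. Qed.

Lemma dotBl n (u v w : 'cV[R]_n) : dot (u - v) w = dot u w - dot v w.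
Proof. by rewrite dotDl dotNl. Qed.

Lemma dotBr n (u v w : 'cV[R]_n) : dot u (v - w) = dot u v - dot u w.
Proof. by rewrite dotDr dotNr. Qed.

Lemma dot0l n (v : 'cV[R]_n) : dot 0 v = 0.
Proof. by rewrite -(scale0r 0) dotZl mul0r. Qed.

Lemma dot0r n (u : 'cV[R]_n) : dot u 0 = 0.
Proof. by rewrite dotC dot0l. Qed.

Lemma dot_suml n (I : Type) (r : seq I) (P : pred I) (F : I -> 'cV[R]_n) v :
  dot (\sum_(i <- r | P i) F i) v = \sum_(i <- r | P i) dot (F i) v.
Proof.
by apply: (big_morph (fun u => dot u v)) => [x y|]; rewrite ?dotDl ?dot0l.
Qed.

Lemma dot_sumr n (I : Type) (r : seq I) (P : pred I) (F : I -> 'cV[R]_n) v :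
  dot v (\sum_(i <- r | P i) F i) = \sum_(i <- r | P i) dot v (F i).
Proof. by rewrite dotC dot_suml; apply: eq_bigr => i _; rewrite dotC. Qed.

Lemma dot_mull n p (M : 'M[R]_(p, n)) u v : dot (M *m u) v = dot u (M^T *m v).
Proof. by rewrite /dot trmx_mul mulmxA. Qed.

Lemma dot_mulr n p (M : 'M[R]_(p, n)) u v : dot u (M *m v) = dot (M^T *m u) v.
Proof. by rewrite dot_mull trmxK. Qed.

End Dot.

(** * Energy forms of SPD matrices *)

Section SPD.
Context {R : realType} (n : nat) (B : 'M[R]_n) (B_spd : spd B).

Lemma spd_sym : B^T = B. Proof. by case: B_spd. Qed.

Lemma spd_formC u v : dot (B *m u) v = dot (B *m v) u.
Proof. by rewrite dot_mull spd_sym dotC. Qed.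

Lemma spd_ge0 u : 0 <= dot (B *m u) u.
Proof.
have [->|/(proj2 B_spd)/ltW//] := eqVneq u 0.
by rewrite mulmx0 dot0l.
Qed.

Lemma spd_eq0 u : dot (B *m u) u = 0 -> u = 0.
Proof.
have [//|/(proj2 B_spd)] := eqVneq u 0.
by rewrite lt_neqAle eq_sym => /andP[/eqP h _] /h.
Qed.

Lemma spd_unitmx : B \in unitmx.
Proof.
rewrite -row_free_unit -kermx_eq0; apply/eqP/row_matrixP => i.
rewrite row0; apply: trmx_inj; rewrite trmx0; apply: spd_eq0.
by rewrite -{1}spd_sym -trmx_mul -row_mul mulmx_ker row0 trmx0 dot0l.
Qed.

(** Expand the nonnegative energy of [c *: u - v] and divide by [2 c]. *)
Lemma spd_young (c : R) u v : 0 < c ->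
  dot (B *m u) v <= (c * dot (B *m u) u + c^-1 * dot (B *m v) v) / 2.
Proof.
move=> c_gt0; have := spd_ge0 (c *: u - v).
rewrite mulmxBr -scalemxAr !dotBl !dotBr !dotZl !dotZr (spd_formC v u) => h.
have c_neq0 : c != 0 by rewrite gt_eqF.
rewrite -subr_ge0.
set uu := dot (B *m u) u in h *; set uv := dot (B *m u) v in h *.
set vv := dot (B *m v) v in h *.
have -> : (c * uu + c^-1 * vv) / 2 - uv
  = c^-1 / 2 * (c * (c * uu) - c * uv - (c * uv - vv)) by field.
by apply: mulr_ge0 => //; rewrite divr_ge0 ?invr_ge0 ?ltW.
Qed.

Lemma spd_congr p (F : 'M[R]_(n, p)) :
  (forall y : 'cV_p, F *m y = 0 -> y = 0) -> spd (F^T *m B *m F).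
Proof.
move=> F_inj; split=> [|y y_neq0].
  by rewrite !trmx_mul trmxK spd_sym mulmxA.
rewrite -!mulmxA dot_mull trmxK; apply: (proj2 B_spd).
by apply: contra_neq y_neq0; apply: F_inj.
Qed.

End SPD.

(** * Spectral splitting for a symmetric pencil *)

Section Pencil.
Context {R : realType} (m : nat) (L P : 'M[R]_m) (L_sym : L^T = L).
Context (P_spd : spd P) (V : 'I_m -> 'cV[R]_m) (lam : 'I_m -> R).
Hypothesis V_eig : is_eigenbasis L P V lam.

(** By symmetry of [L] and [P], the pairing of [V k] and [V l] through [L] is both [lam k] and
    [lam l] times their pairing through [P]. *)
Lemma eigenbasis_orth k l : lam k != lam l -> dot (P *m V k) (V l) = 0.
Proof.
have e j : L *m V j = lam j *: (P *m V j) by case: (proj2 V_eig j).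
move=> ne; apply/eqP; have : (lam k - lam l) * dot (P *m V k) (V l) = 0.
  rewrite mulrBl -dotZl -e (spd_formC P_spd (V k)) -dotZl -e.
  by rewrite dot_mull L_sym dotC subrr.
by move/eqP; rewrite mulf_eq0 subr_eq0 (negPf ne).
Qed.

Lemma eigenbasis_coord x : exists c : 'I_m -> R, x = \sum_k c k *: V k.
Proof.
have /memv_sumP[v vV ->] : x \in (\sum_k <[V k]>)%VS.
  have /andP[/eqP + _] := proj1 V_eig.
  by rewrite span_def big_image /= => ->; rewrite memvf.
exists (fun k => sval (sig_eqW (vlineP _ _ (vV k isT)))).
by apply: eq_bigr => k _; case: sig_eqW.
Qed.

(* The cross terms [dot (P *m V k) (V l)] vanish unless [lam k = lam l], so
   [tau P - L] at [\sum_k c_k V_k] equals [P] at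
   [\sum_k sqrt (tau - lam_k) c_k V_k]. *)
Lemma pencil_le (tau : R) (c : 'I_m -> R) x :
  x = \sum_(k | lam k <= tau) c k *: V k ->
  dot (L *m x) x <= tau * dot (P *m x) x.
Proof.
move=> ->; rewrite -subr_ge0.
pose s k := Num.sqrt (tau - lam k).
have := spd_ge0 P_spd (\sum_(k | lam k <= tau) (s k * c k) *: V k).
congr (0 <= _).
rewrite !mulmx_sumr !dot_suml mulr_sumr -sumrB.
apply: eq_bigr => k k_le; rewrite !dot_sumr mulr_sumr -sumrB.
apply: eq_bigr => l l_le.
rewrite -!scalemxAr (proj2 (proj2 V_eig k)) !dotZl !dotZr.
have [e|/eigenbasis_orth ->] := eqVneq (lam k) (lam l); last by ring.
have ss : s k * s l = tau - lam k.
  by rewrite /s -e -expr2 sqr_sqrtr ?subr_ge0.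
move: (dot _ _) => X.
by transitivity (s k * s l * (c k * c l * X)); [ring | rewrite ss; ring].
Qed.

(** Eigenvectors on opposite sides of [tau] have distinct eigenvalues, so the two parts of [x] are
    [P]-orthogonal and dropping the upper one cannot increase the [P]-energy. No orthogonality
    inside an eigenspace is assumed. *)
Lemma pencil_split (tau : R) x : exists (c : 'I_m -> R) z,
  [/\ x = \sum_(k | tau < lam k) c k *: V k + z,
      dot (L *m z) z <= tau * dot (P *m z) z
    & dot (P *m z) z <= dot (P *m x) x].
Proof.
have [c ->] := eigenbasis_coord x.
pose y := \sum_(k | tau < lam k) c k *: V k.
pose z := \sum_(k | lam k <= tau) c k *: V k.
have xE : \sum_k c k *: V k = y + z.
  rewrite (bigID (fun k => tau < lam k)) /=; congr (_ + _).
  by apply: eq_bigl => k; rewrite -leNgt.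
exists c, z; split=> //.
- exact: pencil_le.
- have yz : dot (P *m y) z = 0.
    rewrite mulmx_sumr dot_suml big1 // => k k_gt.
    rewrite dot_sumr big1 // => l l_le.
    rewrite -scalemxAr dotZl dotZr eigenbasis_orth ?mulr0 //.
    by rewrite gt_eqF // (le_lt_trans l_le).
  rewrite xE mulmxDr !dotDl !dotDr (spd_formC P_spd z) yz addr0 add0r.
  by rewrite lerDr (spd_ge0 P_spd).
Qed.

End Pencil.

(** * The energy-orthogonal projection onto the coarse space *)

Section CoarseProjection.
Context {R : realType} (n m : nat) (A : 'M[R]_n) (A_spd : spd A).
Context (Z : 'M[R]_(n, m)) (V0 : {vspace 'cV[R]_n}).
Hypothesis Z_basis : columns_basis Z V0.

(** The coarse correction: [P0 A Z] is [C *m A]. *)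
Let C := Z *m invmx (Z^T *m A *m Z) *m Z^T.

Lemma mulmx_cols (y : 'cV[R]_m) : Z *m y = \sum_k y k 0 *: col k Z.
Proof.
apply/matrixP => i j; rewrite ord1 mxE summxE.
by apply: eq_bigr => k _; rewrite !mxE mulrC.
Qed.

Lemma columns_basis_inj (y : 'cV[R]_m) : Z *m y = 0 -> y = 0.
Proof.
rewrite mulmx_cols => y0; apply/matrixP => k j; rewrite ord1 mxE.
have := basis_free Z_basis : free (image_tuple (fun k : 'I_m => col k Z) 'I_m).
(* The family of columns is indexed by the enumeration of ['I_m], so the coefficients are
   transported along [enum_val]. *)
pose c (i : 'I_#|'I_m|) : R := y (enum_val i) 0.
move/freeP => /(_ c); rewrite -(enum_rankK k); apply.
rewrite -[RHS]y0 [RHS](reindex_onto enum_val enum_rank) => [|i _]; last first.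
  by rewrite enum_rankK.
apply: eq_big => [i|i _]; first by rewrite enum_valK eqxx.
congr (_ *: _).
by rewrite (nth_map k) ?nth_enum_rank -?cardE // -(enum_val_nth k).
Qed.

Lemma columns_basis_mem v : v \in V0 -> exists y, v = Z *m y.
Proof.
have /andP[/eqP <- _] := Z_basis.
rewrite span_def big_image /= => /memv_sumP[w wV ->].
exists (\col_k sval (sig_eqW (vlineP _ _ (wV k isT)))).
rewrite mulmx_cols; apply: eq_bigr => k _; rewrite mxE.
by case: sig_eqW.
Qed.

Lemma coarse_spd : spd (Z^T *m A *m Z).
Proof. exact/spd_congr/columns_basis_inj. Qed.

Lemma coarse_sym : C^T = C.
Proof. by rewrite /C !trmx_mul trmx_inv trmxK (spd_sym coarse_spd) mulmxA. Qed.

Lemma coarse_idem : C *m A *m C = C.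
Proof.
have := spd_unitmx coarse_spd; rewrite /C; set W := Z^T *m A *m Z => W_unit.
by rewrite !mulmxA -(mulmxA _ Z^T) -(mulmxA _ _ Z) -/W mulmxKV.
Qed.

Lemma P0_id v : v \in V0 -> P0 A Z *m v = v.
Proof.
move=> /columns_basis_mem[y ->]; have := spd_unitmx coarse_spd.
rewrite /P0; set W := Z^T *m A *m Z => W_unit.
by rewrite mulmxA -(mulmxA _ Z^T) -(mulmxA _ _ Z) -/W mulmxKV.
Qed.

Lemma P0_idem : P0 A Z *m P0 A Z = P0 A Z.
Proof. by rewrite /P0 -/C mulmxA coarse_idem. Qed.

(** [A *m P0 A Z] is [A *m C *m A], which is symmetric. *)
Lemma P0_adj u v : dot (A *m (P0 A Z *m u)) v = dot (A *m u) (P0 A Z *m v).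
Proof.
have AP0_sym : (A *m P0 A Z)^T = A *m P0 A Z.
  rewrite /P0 -/C mulmxA trmx_mul [(A *m C)^T]trmx_mul coarse_sym.
  by rewrite (spd_sym A_spd) mulmxA.
by rewrite mulmxA dot_mull AP0_sym dot_mull (spd_sym A_spd) mulmxA.
Qed.

Lemma P0_pythagoras u : let w := u - P0 A Z *m u in
  dot (A *m u) u =
    dot (A *m (P0 A Z *m u)) (P0 A Z *m u) + dot (A *m w) w.
Proof.
move=> w; have -> : dot (A *m w) w = dot (A *m u) w.
  rewrite {1}/w mulmxBr dotBl P0_adj /w (mulmxBr (P0 A Z)) mulmxA P0_idem.
  by rewrite subrr dot0r subr0.
by rewrite P0_adj mulmxA P0_idem -dotDr /w subrKC.
Qed.

End CoarseProjection.

(** * Local solves and the neighbour bound *)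

Section Schwarz.
Context {R : realType} (n N : nat) (A : 'M[R]_n) (A_spd : spd A).
Context (nloc : 'I_N -> nat) (Rs : forall i, 'M[R]_(nloc i, n)).
Hypothesis Rs_tr : forall i, Rs i *m (Rs i)^T = 1%:M.

Lemma Bloc_spd i : spd (Bloc A Rs i).
Proof.
have := spd_congr A_spd (F := (Rs i)^T); rewrite trmxK; apply=> y y0.
by rewrite -(mul1mx y) -Rs_tr -mulmxA y0 mulmx0.
Qed.

(* The [A]-orthogonal projection of [u] onto the range of [R_i^T]. *)
Definition local_sol (u : 'cV[R]_n) i : 'cV[R]_n :=
  (Rs i)^T *m (invmx (Bloc A Rs i) *m (Rs i *m (A *m u))).

(** Galerkin orthogonality: testing against the range of [(Rs i)^T] produces [Bloc A Rs i], which
    cancels its inverse. *)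
Lemma local_sol_adj u i (v : 'cV[R]_(nloc i)) :
  dot (A *m local_sol u i) ((Rs i)^T *m v) = dot (A *m u) ((Rs i)^T *m v).
Proof.
rewrite !dot_mulr trmxK /local_sol !mulmxA -/(Bloc A Rs i) mulmxV ?mul1mx //.
exact/spd_unitmx/Bloc_spd.
Qed.

Lemma local_sol_proj u i :
  dot (A *m local_sol u i) (local_sol u i) = dot (A *m u) (local_sol u i).
Proof. exact: local_sol_adj. Qed.

Lemma max_neighboursP i :
  (#|[set j | (Rs j *m A *m (Rs i)^T != 0)%R]| <= max_neighbours A Rs)%N.
Proof.
exact: (leq_bigmax (F := fun i => #|[set j | (Rs j *m A *m (Rs i)^T != 0)%R]|)).
Qed.

Lemma neighbour_sym i j :
  (Rs j *m A *m (Rs i)^T != 0) = (Rs i *m A *m (Rs j)^T != 0).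
Proof.
by rewrite -(inj_eq trmx_inj) trmx0 !trmx_mul trmxK (spd_sym A_spd) mulmxA.
Qed.

Lemma not_neighbour_orth i j (x : 'cV[R]_(nloc i)) (y : 'cV[R]_(nloc j)) :
  Rs j *m A *m (Rs i)^T = 0 -> dot (A *m ((Rs i)^T *m x)) ((Rs j)^T *m y) = 0.
Proof. by move=> ij0; rewrite dot_mulr trmxK !mulmxA ij0 mul0mx dot0l. Qed.

(** Only neighbouring pairs survive in the double sum. Young with constant 1 splits each into two
    half energies, and since being neighbours is symmetric, both halves have the same total. *)
Lemma sum_form_le (x : forall i, 'cV[R]_(nloc i)) :
  let w := \sum_i (Rs i)^T *m x i in
  (dot (A *m w) w <= (max_neighbours A Rs)%:R *
    \sum_i dot (A *m ((Rs i)^T *m x i)) ((Rs i)^T *m x i))%R.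
Proof.
pose u i := (Rs i)^T *m x i; pose q i := dot (A *m u i) (u i).
set k0 := max_neighbours A Rs; pose nb i j := Rs j *m A *m (Rs i)^T != 0.
have q_ge0 i : 0 <= q i by exact: spd_ge0.
have half : \sum_i \sum_(j | nb i j) q i <= k0%:R * \sum_i q i.
  rewrite mulr_sumr; apply: ler_sum => i _; rewrite sumr_const -[X in X <= _]mulr_natl.
  apply: ler_wpM2r => //; rewrite ler_nat (leq_trans _ (max_neighboursP i)) //.
  by rewrite cardsE.
rewrite /= mulmx_sumr dot_suml.
have -> : \sum_i dot (A *m u i) (\sum_j u j) =
          \sum_i \sum_(j | nb i j) dot (A *m u i) (u j).
  apply: eq_bigr => i _; rewrite dot_sumr (bigID (nb i)) /= addrC big1 ?add0r //.
  by move=> j /negPn/eqP /not_neighbour_orth->.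
apply: le_trans (_ : \sum_i \sum_(j | nb i j) (q i / 2 + q j / 2) <= _).
  apply: ler_sum => i _; apply: ler_sum => j _.
  by have := spd_young A_spd (u i) (u j) ltr01; rewrite invr1 !mul1r mulrDl.
apply: le_trans half; rewrite [X in X <= _](_ : _ = \sum_i \sum_(j | nb i j) q i) //.
have swap : \sum_i \sum_(j | nb i j) q j = \sum_i \sum_(j | nb i j) q i.
  rewrite (exchange_big_dep xpredT) //=; apply: eq_bigr => j _.
  by apply: eq_bigl => i; rewrite /nb neighbour_sym.
transitivity (\sum_i \sum_(j | nb i j) q i / 2 +
              \sum_i \sum_(j | nb i j) q j / 2).
  by rewrite -big_split; apply: eq_bigr => i _; rewrite big_split.
have pull (F : 'I_N -> 'I_N -> R) : \sum_i \sum_(j | nb i j) F i j / 2 =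
    (\sum_i \sum_(j | nb i j) F i j) / 2.
  by rewrite mulr_suml; apply: eq_bigr => i _; rewrite mulr_suml.
by rewrite !pull swap -splitr.
Qed.

(** For [w] the sum of the local solutions, a(w, w) <= k0 a(u, w); Young with constant k0 bounds
    a(u, w) by half of k0 a(u, u) + a(u, w). *)
Lemma sum_local_sol_le u :
  \sum_i dot (A *m u) (local_sol u i) <=
    (max_neighbours A Rs)%:R * dot (A *m u) u.
Proof.
set k0 : R := (max_neighbours A Rs)%:R; pose w := \sum_i local_sol u i.
rewrite -dot_sumr -/w.
have ww : dot (A *m w) w <= k0 * dot (A *m u) w.
  suff -> : dot (A *m u) w = \sum_i dot (A *m local_sol u i) (local_sol u i).
    exact: sum_form_le.
  by rewrite dot_sumr; apply: eq_bigr => i _; rewrite local_sol_proj.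
(* Young needs a positive constant; if k0 is 0, then [w] has zero energy and vanishes. *)
have [k0E|k0_gt0] := eqVneq k0 0.
  move: ww; rewrite k0E !mul0r => ww; have w0 : w = 0.
    by apply: (spd_eq0 A_spd); apply/le_anti; rewrite ww spd_ge0.
  by rewrite w0 dot0r.
have {}k0_gt0 : 0 < k0 by rewrite lt0r k0_gt0 ler0n.
have := spd_young A_spd u w k0_gt0.
have : k0^-1 * dot (A *m w) w <= dot (A *m u) w by rewrite ler_pdivrMl.
lra.
Qed.

End Schwarz.

(** * Energy bounds for the two-level preconditioner *)

Section TwoLevel.
Context {R : realType} (n N m : nat) (A : 'M[R]_n) (A_spd : spd A).
Context (nloc : 'I_N -> nat) (Rs : forall i, 'M[R]_(nloc i, n)).
Hypothesis Rs_tr : forall i, Rs i *m (Rs i)^T = 1%:M.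
Context (Z : 'M[R]_(n, m)) (V0 : {vspace 'cV[R]_n}).
Hypothesis Z_basis : columns_basis Z V0.

Let M := MAS2_inv A Rs Z.
Let energy u := dot (A *m u) u.

Lemma P0_tr_mul : (P0 A Z)^T *m A = A *m P0 A Z.
Proof.
rewrite /P0; set C := Z *m _ *m _.
have := coarse_sym A_spd Z_basis; rewrite -/C => C_sym.
by rewrite trmx_mul C_sym (spd_sym A_spd) mulmxA.
Qed.

(** The right factor of the preconditioner turns [A *m u] into [A *m w]; the left one moves onto [u]
    by self-adjointness of [P0] in the energy product. *)
Lemma schwarz_form u : let w := u - P0 A Z *m u in
  dot (A *m (M *m A *m u)) u =
    energy (P0 A Z *m u) + \sum_i dot (A *m w) (local_sol A Rs w i).
Proof.
move=> w; pose s := \sum_i local_sol A Rs w i.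
have -> : M *m A *m u = P0 A Z *m u + (s - P0 A Z *m s).
  rewrite /M /MAS2_inv 2!mulmxDl -/(P0 A Z); congr (_ + _).
  have sE : s = (\sum_i (Rs i)^T *m invmx (Bloc A Rs i) *m Rs i) *m (A *m w).
    by rewrite /s mulmx_suml; apply: eq_bigr => i _; rewrite /local_sol !mulmxA.
  have wE : A *m w = (1%:M - (P0 A Z)^T) *m A *m u.
    by rewrite mulmxBl mul1mx P0_tr_mul mulmxBl /w mulmxBr mulmxA.
  transitivity ((1%:M - P0 A Z) *m s); first by rewrite sE wE !mulmxA.
  by rewrite mulmxBl mul1mx.
rewrite mulmxDr dotDl; congr (_ + _).
  by rewrite /energy -{1}(P0_idem A_spd Z_basis) -mulmxA (P0_adj A_spd Z_basis).
rewrite mulmxBr dotBl (P0_adj A_spd Z_basis) -dotBr -/w (spd_formC A_spd).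
exact: dot_sumr.
Qed.

(** The coarse energy enters with factor 1, absorbed by k0 >= 1. *)
Lemma schwarz_form_le u : (0 < max_neighbours A Rs)%N ->
  dot (A *m (M *m A *m u)) u <= (max_neighbours A Rs)%:R * energy u.
Proof.
move=> k0_gt0; rewrite schwarz_form /energy (P0_pythagoras A_spd Z_basis u).
rewrite mulrDr; apply: lerD; last exact: sum_local_sol_le.
by apply: ler_peMl; rewrite ?ler1n // spd_ge0.
Qed.

(* Lions' stable decomposition lemma. *)
Lemma schwarz_form_ge (C : R) u (U : forall i, 'cV[R]_(nloc i)) : 0 < C ->
  let w := u - P0 A Z *m u in
  let v := \sum_i (Rs i)^T *m U i in
  w = v - P0 A Z *m v ->
  energy (P0 A Z *m u) + \sum_i energy ((Rs i)^T *m U i) <= C * energy u ->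
  energy u <= C * dot (A *m (M *m A *m u)) u.
Proof.
move=> C_gt0 w v wv stable; rewrite schwarz_form -/w.
set p := P0 A Z *m u in stable *; pose x i := (Rs i)^T *m U i.
have P0w : P0 A Z *m w = 0.
  by rewrite /w mulmxBr mulmxA (P0_idem A_spd Z_basis) subrr.
(* Since [P0] kills [w], a(w, w) = a(w, v), and each local term is a Galerkin identity. *)
have wE : energy w = \sum_i dot (A *m local_sol A Rs w i) (x i).
  rewrite /energy {2}wv dotBr -(P0_adj A_spd Z_basis).
  rewrite P0w mulmx0 dot0l subr0 dot_sumr.
  by apply: eq_bigr => i _; rewrite local_sol_adj.
have young : energy w <=
    (C * (\sum_i dot (A *m w) (local_sol A Rs w i)) +
     C^-1 * \sum_i energy (x i)) / 2.
  rewrite wE !mulr_sumr -big_split mulr_suml; apply: ler_sum => i _.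
  by rewrite /= -local_sol_proj //; exact: spd_young.
(* Young for [p] against itself gives the coarse term the same weights as the local ones, so that
   the two bounds add up. *)
have young0 : energy p <= (C * energy p + C^-1 * energy p) / 2.
  exact: spd_young.
have {}stable : C^-1 * (energy p + \sum_i energy (x i)) <= energy u.
  by rewrite ler_pdivrMl.
have uE : energy u = energy p + energy w by exact: (P0_pythagoras A_spd Z_basis u).
rewrite uE in stable *; move: young young0 stable.
move: (energy p) (energy w) (\sum_i dot _ _) (\sum_i _) => ep ew sl sx.
by rewrite mulrDr; lra.
Qed.

Lemma MAS2_inv_sym : M^T = M.
Proof.
have := coarse_sym A_spd Z_basis; rewrite /M /MAS2_inv.
set C := Z *m _ *m _ => C_sym; move: (P0 A Z) => P.
set S := \sum_i _.
have S_sym : S^T = S.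
  rewrite /S linear_sum; apply: eq_bigr => i _ /=.
  by rewrite !trmx_mul trmxK trmx_inv (spd_sym (Bloc_spd A_spd Rs_tr i)) mulmxA.
have <- : (1%:M - P)^T = 1%:M - P^T by rewrite linearB /= trmx1.
rewrite linearD /= C_sym; congr (_ + _); move: (1%:M - P) => Q.
by rewrite !trmx_mul trmxK S_sym mulmxA.
Qed.

End TwoLevel.

(** * From energy bounds to definiteness and the condition number *)

Lemma spd_of_form {R : realType} n (A M : 'M[R]_n) (C : R) :
  spd A -> M^T = M -> 0 < C ->
  (forall u, dot (A *m u) u <= C * dot (A *m (M *m A *m u)) u) -> spd M.
Proof.
move=> A_spd M_sym C_gt0 lower; split=> // r r_neq0.
have A_unit := spd_unitmx A_spd; pose u := invmx A *m r.
have Au : A *m u = r by rewrite mulmxA mulmxV ?mul1mx.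
have u_neq0 : u != 0 by apply: contra_neq r_neq0 => u0; rewrite -Au u0 mulmx0.
have := lt_le_trans (proj2 A_spd _ u_neq0) (lower u).
by rewrite pmulr_rgt0 // (spd_formC A_spd) -mulmxA Au dotC.
Qed.

Lemma spectral_cond_le {R : realType} n (A M : 'M[R]_n) (C k : R) :
  spd A -> M^T = M -> 0 < C -> 0 <= k ->
  (forall u, dot (A *m u) u <= C * dot (A *m (M *m A *m u)) u) ->
  (forall u, u != 0 -> dot (A *m (M *m A *m u)) u <= k * dot (A *m u) u) ->
  spectral_cond (M *m A) <= C * k.
Proof.
move=> A_spd M_sym C_gt0 k_ge0 lower upper.
have bounds x : eigenvalue (M *m A) x -> C^-1 <= x <= k.
  move=> /eigenvalueP[v vMA v_neq0].
  (* Transposing the left eigenvector [v] and applying the inverse of [A] gives a right eigenvector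
     [u], whose Rayleigh quotient is [x]. *)
  have A_unit := spd_unitmx A_spd; pose u := invmx A *m v^T.
  have Au : A *m u = v^T by rewrite mulmxA mulmxV ?mul1mx.
  have u_neq0 : u != 0.
    apply: contra_neq v_neq0 => u0; apply: trmx_inj.
    by rewrite -Au u0 mulmx0 trmx0.
  have AMA : A *m (M *m A *m u) = x *: (A *m u).
    rewrite -mulmxA Au -linearZ -vMA /= trmx_mul trmx_mul.
    by rewrite M_sym (spd_sym A_spd) mulmxA.
  have Au_gt0 := proj2 A_spd _ u_neq0.
  have := lower u; have := upper u u_neq0; rewrite AMA dotZl.
  rewrite ler_pM2r // mulrA => -> /=.
  by rewrite -[X in X <= _ -> _]mul1r ler_pM2r // andbT -[C^-1]mulr1 ler_pdivrMl.
rewrite /spectral_cond; set S := (X in sup X).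
(* For an empty spectrum [sup] takes its default value 0. *)
have [->|/classical_sets.set0P S_neq0] := eqVneq S classical_sets.set0.
  by rewrite sup0 mul0r mulr_ge0 // ltW.
have inf_ge : C^-1 <= inf S by apply: lb_le_inf => // x /bounds/andP[].
have sup_le : sup S <= k by apply: ge_sup => // x /bounds/andP[].
have inf_gt0 : 0 < inf S by rewrite (lt_le_trans _ inf_ge) ?invr_gt0.
rewrite ler_pdivrMr //; apply: le_trans sup_le _.
by rewrite mulrAC ler_peMl // -ler_pdivrMl // mulr1.
Qed.

(** * Restrictions and overlap counts *)

Lemma restriction_mulmx_tr {R : realType} n m (S : {set 'I_n}) (Ri : 'M[R]_(m, n)) :
  is_restriction S Ri -> Ri *m Ri^T = 1%:M.
Proof.
case=> s [s_inj _ ->]; apply/matrixP => k l; rewrite !mxE (bigD1 (s k)) //=.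
rewrite !mxE eqxx mul1r big1 ?addr0 => [|j /negPf j_neq].
  by rewrite (inj_eq s_inj) eq_sym.
by rewrite !mxE eq_sym j_neq mul0r.
Qed.

Lemma is_diag_mx_tr {R : realType} n (D : 'M[R]_n) : is_diag_mx D -> D^T = D.
Proof. by move=> /diag_mxP[d ->]; rewrite tr_diag_mx. Qed.

(** If k0 were 0, no subdomain would neighbour itself, so each piece of [u] in the partition of
    unity would have zero energy. *)
Lemma max_neighbours_gt0 {R : realType} n N (nloc : 'I_N -> nat) (A : 'M[R]_n)
    (Rs : forall i, 'M[R]_(nloc i, n)) (D : forall i, 'M[R]_(nloc i)) (u : 'cV[R]_n) :
  spd A -> \sum_(i < N) (Rs i)^T *m D i *m Rs i = 1%:M -> u != 0 ->
  (0 < max_neighbours A Rs)%N.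
Proof.
move=> A_spd D_pu; apply: contraNT; rewrite -eqn0Ngt => /eqP k0E.
rewrite -(mul1mx u) -D_pu mulmx_suml big1 // => i _.
apply: (spd_eq0 A_spd); rewrite -!mulmxA.
apply: not_neighbour_orth; apply/eqP; apply/negPn/negP => ii.
have := max_neighboursP A Rs i; rewrite k0E leqn0 cards_eq0 => /eqP/setP/(_ i).
by rewrite !inE ii.
Qed.

Lemma sum_multiplicity_le {R : realType} N (E : finType) (Om : 'I_N -> {set E})
    (q : E -> R) : (forall K, 0 <= q K) ->
  \sum_i \sum_(K in Om i) q K <= (max_multiplicity Om)%:R * \sum_K q K.
Proof.
move=> q_ge0; rewrite (exchange_big_dep xpredT) //= mulr_sumr.
apply: ler_sum => K _; rewrite sumr_const -[X in X <= _]mulr_natl.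
apply: ler_wpM2r => //; rewrite ler_nat -cardsE.
exact: (leq_bigmax (F := fun K => #|[set i | K \in Om i]|)).
Qed.

(** * Local splitting by the GenEO eigenproblem *)

Section GenEO.
Context {R : realType} (n N : nat) (nloc : 'I_N -> nat) (A : 'M[R]_n).
Context (Rs : forall i, 'M[R]_(nloc i, n)) (D xi ANeu : forall i, 'M[R]_(nloc i)).
Context (G : {vspace 'cV[R]_n}).
Context (V : forall j : 'I_N, 'I_(nloc j) -> 'cV[R]_(nloc j)).
Context (lam : forall j : 'I_N, 'I_(nloc j) -> R) (tau : R).

Lemma mem_V_G i g : g \in Gloc Rs G i -> (Rs i)^T *m D i *m g \in V_G Rs D G.
Proof.
move=> gG; apply: (subvP (sumv_sup i _ (subvv _))) => //.
by have := memv_img (linfun (mulmx ((Rs i)^T *m D i))) gG; rewrite lfunE.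
Qed.

Lemma mem_V_geneo i (c : 'I_(nloc i) -> R) :
  (Rs i)^T *m D i *m (1%:M - xi i) *m (\sum_(k | tau < lam k) c k *: V k)
    \in V_geneo Rs D xi V lam tau.
Proof.
apply: (subvP (sumv_sup i _ (subvv _))) => //.
rewrite mulmx_sumr; apply: memv_sumr => k _.
by rewrite -scalemxAr memvZ ?memv_line.
Qed.

(* Only the part of [R_i u] spanned by the eigenvectors below the threshold is
   left to the local spaces: its [xi_i]-component goes to [V_G], and its
   component above the threshold to [V_geneo]. *)
Lemma geneo_local_split i u :
  spd A -> (D i)^T = D i -> spd (ANeu i) ->
  (forall x, xi i *m x \in Gloc Rs G i) ->
  is_eigenbasis (geneo_mx A Rs D xi i) (ANeu i) (@V i) (@lam i) ->
  0 <= tau ->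
  exists U : 'cV_(nloc i),
    (Rs i)^T *m D i *m Rs i *m u - (Rs i)^T *m U
      \in (V_G Rs D G + V_geneo Rs D xi V lam tau)%VS /\
    dot (A *m ((Rs i)^T *m U)) ((Rs i)^T *m U) <=
      tau * dot (ANeu i *m (Rs i *m u)) (Rs i *m u).
Proof.
move=> A_spd D_sym ANeu_spd xiG V_eig tau_ge0.
pose Q := 1%:M - xi i.
have LE : geneo_mx A Rs D xi i =
    Q^T *m D i *m Rs i *m A *m (Rs i)^T *m D i *m Q.
  by have -> : Q^T = 1%:M - (xi i)^T by rewrite /Q linearB /= trmx1.
have L_sym : (geneo_mx A Rs D xi i)^T = geneo_mx A Rs D xi i.
  rewrite LE; move: Q {LE} => Q.
  by rewrite !trmx_mul !trmxK (spd_sym A_spd) D_sym !mulmxA.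
have [c [z [xE Lz Pz]]] := pencil_split L_sym ANeu_spd V_eig tau (Rs i *m u).
(* For this choice the energy of [(Rs i)^T *m U] is exactly the form of [geneo_mx] at [z]. *)
exists (D i *m (1%:M - xi i) *m z); split; last first.
  apply: le_trans (ler_wpM2l tau_ge0 Pz); apply: le_trans Lz.
  rewrite LE -/Q; move: Q {LE} => Q.
  by rewrite -!mulmxA [X in _ <= X]dot_mull trmxK [X in _ <= X]dot_mull D_sym
    [X in _ <= X]dot_mull.
set y := \sum_(k | tau < lam k) c k *: V k in xE *.
have -> : (Rs i)^T *m D i *m Rs i *m u - (Rs i)^T *m (D i *m (1%:M - xi i) *m z)
  = (Rs i)^T *m D i *m (xi i *m (Rs i *m u)) +
    (Rs i)^T *m D i *m (1%:M - xi i) *m y.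
  rewrite -!mulmxA -!mulmxBr -!mulmxDr; congr (_ *m (_ *m _)).
  rewrite !mulmxBl !mul1mx xE !mulmxDr.
  move: (xi i *m y) (xi i *m z) => a b.
  by rewrite opprB addrA addrAC addrK (addrC a) -addrA subrKC addrC.
by apply: memv_add; [exact: mem_V_G | exact: mem_V_geneo].
Qed.

End GenEO.

(** * Stable decomposition and the final estimate *)

Theorem mainTheorem1
  (R : realType) (n N : nat)
  (* mesh, element bilinear forms and global matrix *)
  (E : finType) (edof : E -> {set 'I_n})
  (a : E -> {biscalar 'cV[R]_n})
  (a_sym : forall K u v, a K u v = a K v u)
  (a_psd : forall K u, 0 <= a K u u)
  (A : 'M[R]_n) (A_spd : spd A)
  (A_form : forall u v : 'cV[R]_n, dot (A *m u) v = \sum_(K : E) a K u v)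
  (* overlapping subdomains, restrictions, partition of unity *)
  (Om : 'I_N -> {set E}) (Om_cover : \bigcup_(i < N) Om i = [set: E])
  (nloc : 'I_N -> nat)
  (Rs : forall i : 'I_N, 'M[R]_(nloc i, n))
  (Rs_restr : forall i, is_restriction (dofs_of edof (Om i)) (Rs i))
  (D : forall i : 'I_N, 'M[R]_(nloc i))
  (D_diag : forall i, is_diag_mx (D i))
  (D_pu : \sum_(i < N) (Rs i)^T *m D i *m Rs i = 1%:M)
  (* local Neumann matrices *)
  (ANeu : forall i : 'I_N, 'M[R]_(nloc i))
  (ANeu_form : forall i (u v : 'cV[R]_n),
     dot (ANeu i *m (Rs i *m u)) (Rs i *m v) = \sum_(K in Om i) a K u v)
  (ANeu_spd : forall i, spd (ANeu i))
  (* near-kernel space and local projections *)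
  (G : {vspace 'cV[R]_n})
  (xi : forall i : 'I_N, 'M[R]_(nloc i))
  (xi_proj : forall i, is_orth_proj (Bloc A Rs i) (Gloc Rs G i) (xi i))
  (* GenEO eigenpairs and coarse space *)
  (V : forall j : 'I_N, 'I_(nloc j) -> 'cV[R]_(nloc j))
  (lam : forall j : 'I_N, 'I_(nloc j) -> R)
  (V_eig : forall j,
     is_eigenbasis (geneo_mx A Rs D xi j) (ANeu j) (V j) (lam j))
  (tau : R) (tau_gt0 : 0 < tau)
  (m : nat) (Z : 'M[R]_(n, m))
  (Z_basis : columns_basis Z (V_G Rs D G + V_geneo Rs D xi V lam tau)%VS) :
  spd (MAS2_inv A Rs Z) /\
  spectral_cond (MAS2_inv A Rs Z *m A)
    <= (1 + (max_multiplicity Om)%:R * tau) * (max_neighbours A Rs)%:R.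
Proof.
have Rs_tr i : Rs i *m (Rs i)^T = 1%:M := restriction_mulmx_tr (Rs_restr i).
have C_gt0 : 0 < 1 + (max_multiplicity Om)%:R * tau.
  by rewrite ltr_pwDl // mulr_ge0 ?ler0n // ltW.
have M_sym := MAS2_inv_sym A_spd Rs_tr Z_basis.
have lower u : dot (A *m u) u <= (1 + (max_multiplicity Om)%:R * tau) *
    dot (A *m (MAS2_inv A Rs Z *m A *m u)) u.
  have split_i i := geneo_local_split u A_spd (is_diag_mx_tr (D_diag i))
    (ANeu_spd i) (fun x => proj1 (xi_proj i x)) (V_eig i) (ltW tau_gt0).
  pose U i := sval (cid (split_i i)).
  have U_mem i := proj1 (svalP (cid (split_i i))).
  have U_le i := proj2 (svalP (cid (split_i i))).
  apply: (schwarz_form_ge A_spd Rs_tr Z_basis (U := U)) => //.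
    set v := \sum_i _.
    have uv : u - v \in (V_G Rs D G + V_geneo Rs D xi V lam tau)%VS.
      rewrite -(mul1mx u) -D_pu mulmx_suml -sumrB; apply: rpred_sum => i _.
      exact: U_mem.
    (* [P0] fixes [u - v], so [u] and [v] have the same component under [1 - P0]. *)
    have := P0_id A_spd Z_basis uv; rewrite mulmxBr => e.
    have {1}-> : u = P0 A Z *m u - P0 A Z *m v + v by rewrite e subrK.
    by rewrite addrC addrA addKr addrC.
  (* The summand 1 of the constant pays for the coarse component, the summand k1 tau for the local
     ones. *)
  rewrite mulrDl mul1r; apply: lerD.
    by rewrite (P0_pythagoras A_spd Z_basis u) lerDl spd_ge0.
  apply: le_trans (ler_sum _ (fun i _ => U_le i)) _.
  rewrite -mulr_sumr [_%:R * tau]mulrC -mulrA (ler_wpM2l (ltW tau_gt0)) // A_form.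
  under eq_bigr do rewrite ANeu_form.
  exact: (sum_multiplicity_le Om (fun K => a_psd K u)).
split; first exact: spd_of_form lower.
apply: spectral_cond_le => // u u_neq0.
apply: (schwarz_form_le A_spd Rs_tr Z_basis).
exact: max_neighbours_gt0 D_pu u_neq0.
Qed.
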